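(* Let $(N,+,* )$ be a simple f-near-ring with DCCN and let $U$ be its set of units. (i) If $N$ is a ring with $|U|=1$, then $N$ is isomorphic to a direct product of copies of the field $\mathbb{Z}_2$. (ii) If $N$ is a ring with $|U|\ge2$, then $N$ is a field. (iii) If $N$ is not a ring, then $N$ is a near-field.
   Context: A near-ring $(N,+,* )$ is a (not necessarily abelian) group $(N,+)$ with identity element $0$ together with a semigroup $(N,* )$ satisfying the right distributive law $(a+b)*c=a*c+b*c$. It is zero symmetric if $0*n=n*0=0$ for all $n$. For a near-ring with multiplicative identity $1$, $U$ denotes the group of multiplicatively invertible elements (units), and for $u\in N$, $\psi_u:N\to N$ is $n\mapsto n*u$. A near-field is a near-ring whose non-zero elements are all units, forming a group under multiplication. An f-near-ring is a zero symmetric near-ring with identity such that $\{\psi_u\mid u\in U\}$ acts as a fixed point free automorphism group on $(N,+)$, i.e. for every unit $u$ with $\psi_u\ne\mathrm{id}$, the only $n\in N$ with $n*u=n$ is $n=0$. An ideal of $N$ is the kernel of a near-ring homomorphism, i.e. a normal subgroup $I$ of $(N,+)$ with $I*N\subseteq I$ and $n*(m+i)-n*m\in I$ for all $n,m\in N$, $i\in I$; $N$ is simple if its only ideals are $\{0\}$ and $N$. An $N$-subgroup of $N$ is a subgroup $H$ of $(N,+)$ with $N*H\subseteq H$; DCCN is the descending chain condition on $N$-subgroups of $N$.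
   Formalization: In (ii), ''field'' is replaced by ''skew field'' (multiplication need not commute), since the claim fails for commutative fields: the rational quaternions are a simple f-near-ring with DCCN, a ring with |U| ≥ 2, and not commutative. *)

(* Defs.v *)
From HB Require Import structures.
From mathcomp Require Import all_boot all_algebra.
From mathcomp Require Import boolp classical_sets functions cardinality.

Set Implicit Arguments.
Unset Strict Implicit.
Unset Printing Implicit Defensive.

Local Open Scope classical_set_scope.
Local Open Scope ring_scope.

(* The multiplication of a near-ring is the one of [magmaType]: the products of
   the [GRing] hierarchy presuppose a commutative addition. *)
Reserved Notation "x ** y" (at level 40, left associativity).
Notation "x ** y" := (monoid.mul x y) : ring_scope.

(* [zmodType] is not used for (N, +), since it imposes commutativity;
   [baseZmodType] only supplies the operations 0, + and -. *)
HB.mixin Record isNearRing N of Algebra.BaseZmodule N & Magma N := {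
  nr_addA : associative (@Algebra.add N) ;
  nr_add0r : left_id 0 (@Algebra.add N) ;
  nr_addNr : left_inverse 0 (@Algebra.opp N) (@Algebra.add N) ;
  nr_mulA : associative (@monoid.mul N) ;
  nr_mulDl : forall a b c : N, (a + b) ** c = a ** c + b ** c
}.

#[short(type="nearRingType")]
HB.structure Definition NearRing :=
  {N of isNearRing N & Algebra.BaseZmodule N & Magma N}.

HB.mixin Record isUnitalNearRing N of BaseUMagma N := {
  nr_mul1n : left_id 1%g (@monoid.mul N) ;
  nr_muln1 : right_id 1%g (@monoid.mul N)
}.

#[short(type="unitalNearRingType")]
HB.structure Definition UnitalNearRing :=
  {N of isUnitalNearRing N & NearRing N & BaseUMagma N}.

Definition zero_symmetric (N : nearRingType) : Prop :=
  forall n : N, 0 ** n = 0 /\ n ** 0 = 0.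

Definition units (N : unitalNearRingType) : set N :=
  [set u | exists v, u ** v = 1%g /\ v ** u = 1%g].
Arguments units : clear implicits.

Definition psi (N : nearRingType) (u n : N) : N := n ** u.

(* That the maps [psi u], for u a unit, form a group of automorphisms of (N, +)
   holds in every near-ring with identity, by right distributivity. *)
Definition f_near_ring (N : unitalNearRingType) : Prop :=
  zero_symmetric N /\
  (forall u : N, units N u -> ~ (psi u =1 id) ->
     forall n : N, psi u n = n -> n = 0).

Definition add_subgroup (N : nearRingType) (H : set N) : Prop :=
  H 0 /\ (forall x y, H x -> H y -> H (x - y)).

Definition add_normal (N : nearRingType) (I : set N) : Prop :=
  add_subgroup I /\ (forall n i, I i -> I (n + i - n)).

Definition ideal (N : nearRingType) (I : set N) : Prop :=
  [/\ add_normal I,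
      forall i n, I i -> I (i ** n)
    & forall n m i, I i -> I (n ** (m + i) - n ** m)].

Definition simple_near_ring (N : nearRingType) : Prop :=
  forall I : set N, ideal I -> I = [set 0] \/ I = [set: N].

Definition N_subgroup (N : nearRingType) (H : set N) : Prop :=
  add_subgroup H /\ (forall n h, H h -> H (n ** h)).

Definition DCCN (N : nearRingType) : Prop :=
  forall H : nat -> set N,
    (forall k, N_subgroup (H k)) -> (forall k, H k.+1 `<=` H k) ->
    exists k, forall m, (k <= m)%N -> H m = H k.

Definition is_ring (N : nearRingType) : Prop :=
  (forall x y : N, x + y = y + x) /\
  (forall x y z : N, x ** (y + z) = x ** y + x ** z).

(* [1 <> 0], because the non-zero elements form a group. *)
Definition near_field (N : unitalNearRingType) : Prop :=
  (1%g : N) <> 0 /\ (forall x : N, x <> 0 -> units N x).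

(* A near-field that is a ring, i.e. a field whose product need not commute.
   Commutativity cannot be expected here: the rational quaternions are a simple
   f-near-ring with DCCN and more than one unit. *)
Definition skew_field (N : unitalNearRingType) : Prop :=
  is_ring N /\ near_field N.

(* The power of the field with two elements, with pointwise operations, over an
   arbitrary (possibly empty or infinite) set of indices [I]. *)
Definition isomorphic_to_power_F2 (N : nearRingType) : Prop :=
  exists (I : Type) (f : N -> I -> 'F_2),
    [/\ bijective f,
        forall x y i, f (x + y) i = f x i + f y i
      & forall x y i, f (x ** y) i = f x i * f y i].

(* Main.v *)
(** Let [H] be a minimal nonzero N-subgroup. Every nonzero [h] in [H] satisfies
    [N ** h = H], and by simplicity [N] acts faithfully on [H]. Call a subset [A]
    of [H] free if every map [A -> H] is the action of some element of [N]. If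
    some [m] kills a free [A] but not [h] in [H], then [A] together with [h] is
    free, so DCCN yields a free [A] whose annihilator is [0]. If [A] had two
    distinct elements [a] and [b], the [u] swapping them and fixing the rest of
    [A] would be a unit other than [1], and the [n] mapping both to [a] and the
    rest of [A] to [0] would be a nonzero fixed point of [psi u]. Hence [A] is a
    singleton, and [n |-> n ** a] identifies [N] with [H], so that every nonzero
    element of [N] has a left inverse. *)

Require Import Defs.
From mathcomp Require Import all_boot all_algebra.
From mathcomp Require Import boolp classical_sets functions cardinality.

Set Implicit Arguments.
Unset Strict Implicit.
Unset Printing Implicit Defensive.

Local Open Scope classical_set_scope.
Local Open Scope card_scope.
Local Open Scope ring_scope.

(** * Group laws, annihilators and descending chains *)

Section NearRingTheory.
Variable N : nearRingType.
Implicit Types x y z n h : N.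

Lemma nr_addrN x : x - x = 0.
Proof.
rewrite -[LHS]nr_add0r -{1}(nr_addNr (- x)) -nr_addA [_ + (x - x)]nr_addA.
by rewrite nr_addNr nr_add0r nr_addNr.
Qed.

Lemma nr_addr0 x : x + 0 = x.
Proof. by rewrite -(nr_addNr x) nr_addA nr_addrN nr_add0r. Qed.

Lemma nr_addr0_eq x y : x + y = 0 -> y = - x.
Proof.
by move=> xy; rewrite -[y]nr_add0r -(nr_addNr x) -nr_addA xy nr_addr0.
Qed.

Lemma nr_opprK x : - - x = x.
Proof. by rewrite -(nr_addr0_eq (nr_addNr x)). Qed.

Lemma nr_subr0_eq x y : x - y = 0 -> x = y.
Proof. by move=> /nr_addr0_eq/(congr1 (@Algebra.opp N)); rewrite !nr_opprK. Qed.

Hypothesis N0 : zero_symmetric N.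

Lemma nr_mulNl x y : (- x) ** y = - (x ** y).
Proof. by apply: nr_addr0_eq; rewrite -nr_mulDl nr_addrN (N0 y).1. Qed.

Lemma nr_mulBl x y z : (x - y) ** z = x ** z - y ** z.
Proof. by rewrite nr_mulDl nr_mulNl. Qed.

Definition annihilator (A : set N) : set N :=
  [set n | forall h, A h -> n ** h = 0].

Lemma annihilator_normal A : add_normal (annihilator A).
Proof.
split; first split.
- by move=> h _; case: (N0 h).
- by move=> x y Ax Ay h Ah; rewrite nr_mulBl Ax// Ay// nr_addrN.
- by move=> n i Ai h Ah; rewrite nr_mulBl nr_mulDl Ai// nr_addr0 nr_addrN.
Qed.

Lemma annihilator_N_subgroup A : N_subgroup (annihilator A).
Proof.
split=> [|n i Ai h Ah]; first by case: (annihilator_normal A).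
by rewrite -nr_mulA Ai//; case: (N0 n).
Qed.

(** Stability of [H] under left multiplication makes [i ** n] kill [H], and right distributivity
    cancels [n ** m] in the last clause. *)
Lemma annihilator_ideal H : N_subgroup H -> ideal (annihilator H).
Proof.
move=> [_ HN]; split; first exact: annihilator_normal.
- by move=> i n Hi h Hh; rewrite -nr_mulA Hi//; apply: HN.
- move=> n m i Hi h Hh; rewrite nr_mulBl -!nr_mulA nr_mulDl Hi//.
  by rewrite nr_addr0 nr_addrN.
Qed.

Lemma orbit_N_subgroup h : N_subgroup (range (fun n => n ** h)).
Proof.
split; first split.
- by exists 0 => //; case: (N0 h).
- by move=> _ _ [x _ <-] [y _ <-]; exists (x - y); rewrite ?nr_mulBl.
- by move=> n _ [x _ <-]; exists (n ** x); rewrite ?nr_mulA.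
Qed.

Lemma add_subgroupD (H : set N) x y : add_subgroup H -> H x -> H y -> H (x + y).
Proof.
move=> [H0 Hsub] Hx Hy; rewrite -[y]nr_opprK -[- y]nr_add0r.
by apply: (Hsub) => //; apply: Hsub.
Qed.

(** Without a minimal member, choice assigns to each member a strictly smaller one, and iterating
    from [H0] gives a chain that never stabilizes. *)
Lemma dccn_minimal (F : set (set N)) : DCCN N -> F `<=` @N_subgroup N ->
  F !=set0 -> exists2 H, F H & forall K, F K -> K `<=` H -> K = H.
Proof.
move=> dcc FN [H0 FH0]; apply: contrapT => noMin.
have smaller (H : {H | F H}) : exists K : {H | F H},
    sval K `<=` sval H /\ sval K <> sval H.
  case: H => H FH /=; apply: contrapT => noK; apply: noMin; exists H => // K FK KH.
  by apply: contrapT => KneH; apply: noK; exists (exist _ K FK).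
have [f fP] := choice smaller.
pose C k := iter k f (exist _ H0 FH0).
have [k Ck] := dcc (fun k => sval (C k)) (fun k => FN _ (svalP (C k)))
  (fun k => (fP (C k)).1).
exact: (fP (C k)).2 (Ck k.+1 (leqnSn k)).
Qed.

End NearRingTheory.

(** * Minimal N-subgroups and free sets *)

Section Minimal.
Variable N : unitalNearRingType.
Implicit Types x y z n h : N.
Hypothesis N0 : zero_symmetric N.
Hypothesis nontrivial : (1%g : N) <> 0.

(** Minimality is recorded in the form in which it is used: each nonzero element generates [H]. *)
Definition minimal_N_subgroup (H : set N) : Prop :=
  [/\ N_subgroup H, exists2 h, H h & h <> 0
    & forall h, H h -> h <> 0 -> range (fun n => n ** h) = H].

Lemma ex_minimal_N_subgroup : DCCN N -> exists H, minimal_N_subgroup H.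
Proof.
move=> dcc.
have [||H [HN Hn0] Hmin] :=
    @dccn_minimal N [set K | N_subgroup K /\ exists2 h, K h & h <> 0] dcc.
- by move=> K [].
- by exists setT; split=> //; exists 1%g.
- exists H; split=> // h Hh h0; apply: Hmin; first split.
  + exact: orbit_N_subgroup.
  + by exists h => //; exists 1%g; rewrite ?nr_mul1n.
  + by move=> _ [n _ <-]; apply: HN.2.
Qed.

Lemma minimal_faithful H : simple_near_ring N -> minimal_N_subgroup H ->
  annihilator H = [set 0].
Proof.
move=> simple [HN [h Hh h0] _].
have [//|annT] := simple _ (annihilator_ideal N0 HN).
have : annihilator H 1%g by rewrite annT.
by move=> /(_ _ Hh); rewrite nr_mul1n.
Qed.

Definition free (H A : set N) : Prop :=
  forall f : N -> N, (forall a, A a -> H (f a)) ->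
    exists n, forall a, A a -> n ** a = f a.

Lemma free0 H : free H set0.
Proof. by move=> f _; exists 0. Qed.

Lemma freeU1 H A h m : minimal_N_subgroup H -> free H A -> H h ->
  annihilator A m -> m ** h <> 0 -> free H (h |` A).
Proof.
move=> [HN _ Hmin] freeA Hh Am mh f fH.
have [n nf] : exists n, forall a, A a -> n ** a = f a.
  by apply: freeA => a Aa; apply: fH; right.
have Hnh : H (- (n ** h) + f h).
  apply: (add_subgroupD HN.1); last by apply: fH; left.
  by rewrite -[- _]nr_add0r; apply: HN.1.2; [exact: HN.1.1|exact: HN.2].
rewrite -(Hmin _ (HN.2 m h Hh) mh) in Hnh; case: Hnh => k _ kmh.
(* The correction [k ** m] vanishes on [A] and supplies at [h] the value missing from [n ** h]. *)
exists (n + k ** m) => a [->|Aa].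
  by rewrite nr_mulDl -nr_mulA kmh nr_addA nr_addrN nr_add0r.
by rewrite nr_mulDl -nr_mulA Am// (N0 k).2 nr_addr0 nf.
Qed.

(** DCCN is applied to the annihilators of free subsets of [H]. At a minimal one, adjoining a point
    [h] not killed by [m] would shrink the annihilator. *)
Lemma ex_free H : DCCN N -> simple_near_ring N -> minimal_N_subgroup H ->
  exists A, [/\ A `<=` H, free H A & annihilator A = [set 0]].
Proof.
move=> dcc simple Hmin.
have [||_ [A [AH freeA] <-] annmin] := @dccn_minimal N
    [set annihilator A | A in [set A | A `<=` H /\ free H A]] dcc.
- by move=> _ [A _ <-]; apply: annihilator_N_subgroup.
- by exists (annihilator set0), set0 => //; split=> //; apply: free0.
exists A; split=> //; apply/seteqP; split=> [m Am|_ -> a _]; last by case: (N0 a).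
rewrite -(minimal_faithful simple Hmin) => h Hh; apply: contrapT => mh.
have mA : annihilator (h |` A) = annihilator A.
  apply: annmin => [|n hn a Aa]; last by apply: hn; right.
  exists (h |` A) => //; split; first by move=> c [->|/AH].
  exact: freeU1 freeA Hh Am mh.
by apply: mh; move: Am; rewrite -mA; apply; left.
Qed.

Lemma free_subsingleton H A : f_near_ring N -> minimal_N_subgroup H ->
  A `<=` H -> free H A -> annihilator A = [set 0] ->
  forall a b, A a -> A b -> a = b.
Proof.
move=> [_ fpf] [HN [h1 Hh1 h10] _] AH freeA annA a b Aa Ab; apply: contrapT => ab.
(* An element of [N] is determined by its action on [A], so identities below are checked on [A]. *)
have annP x y : (forall c, A c -> x ** c = y ** c) -> x = y.
  move=> xy; apply: nr_subr0_eq.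
  suff : annihilator A (x - y) by rewrite annA.
  by move=> c Ac; rewrite nr_mulBl// xy// nr_addrN.
pose swap c := if `[< c = a >] then b else if `[< c = b >] then a else c.
pose proj c := if `[< c = a \/ c = b >] then a else 0.
have swapa : swap a = b by rewrite /swap asboolT.
have swapb : swap b = a by rewrite /swap asboolF 1?asboolT// => /esym.
have swap_id c : c <> a -> c <> b -> swap c = c by move=> *; rewrite /swap !asboolF.
have proja : proj a = a by rewrite /proj asboolT//; left.
have projb : proj b = a by rewrite /proj asboolT//; right.
have swapP c : [\/ c = a, c = b | c <> a /\ c <> b].
  by have [|] := pselect (c = a); have [|] := pselect (c = b);
    [constructor 1|constructor 1|constructor 2|constructor 3].
have Aswap c : A c -> A (swap c).
  by case: (swapP c) => [->|->|[ca cb]]; rewrite ?swapa ?swapb ?swap_id.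
have swapK c : swap (swap c) = c.
  by case: (swapP c) => [->|->|[ca cb]]; rewrite ?(swapa, swapb) ?swap_id.
have proj_swap c : proj (swap c) = proj c.
  by case: (swapP c) => [->|->|[ca cb]]; rewrite ?(swapa, swapb, proja, projb) ?swap_id.
have [u uE] := freeA swap (fun c Ac => AH _ (Aswap c Ac)).
have [n nE] : exists n, forall c, A c -> n ** c = proj c.
  apply: freeA => c _; rewrite /proj.
  by case: asboolP => _; [apply: AH|apply: HN.1.1].
have uu : u ** u = 1%g.
  by apply: annP => c Ac; rewrite nr_mul1n -nr_mulA !uE ?swapK//; apply: Aswap.
have u1 : ~ psi u =1 id.
  move=> /(_ 1%g); rewrite /psi nr_mul1n => u1; have := uE a Aa.
  by rewrite u1 nr_mul1n swapa.
have nu : psi u n = n.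
  by apply: annP => c Ac; rewrite /psi -nr_mulA uE// !nE ?proj_swap//; apply: Aswap.
have n0 : n = 0 by apply: fpf u1 _ nu; exists u.
(* Now [a = n ** a = 0], yet freeness provides some [k] sending [a] to the nonzero [h1]. *)
have a0 : a = 0 by rewrite -proja -nE// n0 (N0 a).1.
have [k kE] := freeA (fun=> h1) (fun _ _ => Hh1).
by apply: h10; rewrite -(kE a Aa) a0 (N0 k).2.
Qed.

Lemma minimal_annihilator0_near_field H h : minimal_N_subgroup H -> H h ->
  annihilator [set h] = [set 0] -> near_field N.
Proof.
move=> [HN _ Hmin] Hh annh; split=> // x x0.
have linv y : y <> 0 -> exists z, z ** y = 1%g.
  move=> y0; have yh : y ** h <> 0.
    by move=> yh; apply: y0; suff : annihilator [set h] y; [rewrite annh|move=> _ ->].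
  have := Hh; rewrite -{1}(Hmin _ (HN.2 y h Hh) yh) => -[z _ zyh]; exists z.
  apply: nr_subr0_eq; suff : annihilator [set h] (z ** y - 1%g) by rewrite annh.
  by move=> _ ->; rewrite nr_mulBl// -nr_mulA zyh nr_mul1n nr_addrN.
(* The left inverse [y] of [x] has a left inverse [z] itself, and associativity gives [x = z]. *)
have [y yx] := linv x x0.
have [|z zy] := linv y.
  by move=> y0; apply: nontrivial; rewrite -yx y0 (N0 x).1.
exists y; split=> //.
suff -> : x = z by [].
by rewrite -[x]nr_mul1n -zy -nr_mulA yx nr_muln1.
Qed.

Lemma f_near_ring_near_field : f_near_ring N -> simple_near_ring N -> DCCN N ->
  near_field N.
Proof.
move=> fN simple dcc.
have [H Hmin] := ex_minimal_N_subgroup dcc.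
have [A [AH freeA annA]] := ex_free dcc simple Hmin.
have [[a Aa]|A0] := pselect (exists a, A a).
  apply: (minimal_annihilator0_near_field Hmin (AH _ Aa)).
  rewrite -annA; congr annihilator; apply/seteqP; split=> [_ ->//|b Ab].
  exact: (free_subsingleton fN Hmin AH freeA annA).
(* An empty [A] is annihilated by everything, including [1]. *)
case: nontrivial; suff : annihilator A 1%g by rewrite annA.
by move=> a Aa; case: A0; exists a.
Qed.

End Minimal.

(** * The zero near-ring, the two-element case and the conclusion *)

Lemma all_eq0_of_oner_eq0 (N : unitalNearRingType) : zero_symmetric N ->
  (1%g : N) = 0 -> forall x : N, x = 0.
Proof. by move=> N0 N10 x; rewrite -[x]nr_muln1 N10; case: (N0 x). Qed.

(** The zero near-ring is the empty product, indexed by [void]. *)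
Lemma trivial_isomorphic_to_power_F2 (N : nearRingType) :
  (forall x : N, x = 0) -> isomorphic_to_power_F2 N.
Proof.
move=> all0; exists void, (fun _ => of_void _); split=> //.
exists (fun=> 0) => [x|g]; first by rewrite (all0 x).
by apply: funext => -[].
Qed.

(** Here [N] is just [0] and [1], and [1 + 1 = 1] is excluded by cancellation; a single copy of
    ['F_2] suffices. *)
Lemma near_field_units1_power_F2 (N : unitalNearRingType) : zero_symmetric N ->
  near_field N -> units N `<=` [set 1%g] -> isomorphic_to_power_F2 N.
Proof.
move=> N0 [one0 inv] U1.
have N01 (x : N) : x = 0 \/ x = 1%g.
  by have [->|/inv/U1] := pselect (x = 0); [left|right].
have one_add_one : (1%g : N) + 1%g = 0.
  have [//|/(congr1 (fun x => - 1%g + x))] := N01 (1%g + 1%g).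
  by rewrite nr_addA nr_addNr nr_add0r.
pose f (x : N) (_ : unit) : 'F_2 := if pselect (x = 0) then 0 else 1.
have f0 i : f 0 i = 0 by rewrite /f; case: pselect.
have f1 i : f 1%g i = 1 by rewrite /f; case: pselect.
exists unit, f; split=> [|x y i|x y i].
- exists (fun g => if g tt == 0 then 0 else 1%g) => [x|g].
    by have [->|->] := N01 x; rewrite ?f0 ?f1.
  apply: funext => -[]; case: ifP => [/eqP ->|]; rewrite ?f0 ?f1//.
  by case: (g tt) => [[|[|//]]] // ? _; apply/val_inj.
- have [->|->] := N01 x; have [->|->] := N01 y;
    rewrite ?nr_add0r ?nr_addr0 ?one_add_one ?f0 ?f1 ?GRing.add0r ?GRing.addr0 //.
  by apply/val_inj.
- have [->|->] := N01 x; have [->|->] := N01 y;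
  by rewrite ?nr_mul1n ?(N0 _).1 ?(N0 _).2 ?f0 ?f1 ?GRing.mul0r ?GRing.mulr0 ?GRing.mul1r.
Qed.

Theorem theorem6p2 (N : unitalNearRingType)
    (N_f : f_near_ring N) (N_simple : simple_near_ring N) (N_dcc : DCCN N) :
  [/\ is_ring N -> units N #= `I_1 -> isomorphic_to_power_F2 N,
      is_ring N -> `I_2 #<= units N -> skew_field N
    & ~ is_ring N -> near_field N].
Proof.
have [N0 _] := N_f.
(* The zero near-ring is not a near-field and is treated apart: it is a ring with exactly one unit,
   so only the first claim concerns it. *)
have [N10|N10] := pselect ((1%g : N) = 0%R).
  have all0 := all_eq0_of_oner_eq0 N0 N10; split=> [_ _|_|[]].
  - exact: trivial_isomorphic_to_power_F2.
  - move=> units2; have : (`I_2 #<= `I_1); last by rewrite card_le_II.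
    apply: card_le_trans units2 _; rewrite -(card_le_eqr (@card_set1 N 0%R)).
    by apply: subset_card_le => x _; apply: all0.
  - by split=> *; rewrite [LHS]all0 [RHS]all0.
have field := f_near_ring_near_field N0 N10 N_f N_simple N_dcc.
split=> // _ /card_set_bijP[g [gfun ginj _]].
have unit1 : units N 1%g by exists 1%g; rewrite !nr_mul1n.
(* The bijection onto [I_1] is constant, so injectivity identifies every unit with [1]. *)
have g0 v : units N v -> g v = 0%N by move=> /gfun /=; case: (g v).
apply: near_field_units1_power_F2 => // u Uu.
by apply: ginj; rewrite ?inE// !g0.
Qed.
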